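(* Assume that $X$ and $Y:=\operatorname{dom}F^*$ are compact, and that $B=I$ (so $\mathcal W=\mathcal Y$), $b=0$. Let $\rho>0$. In the AADMM algorithm (described in the context), if the parameters are set to $$\alpha_t=\frac2{t+1},\quad\tau_t=\rho_t\equiv\rho,\quad\theta_t=\frac{(t-1)\rho}t,\quad\eta_t=\frac{2L_G+\chi\rho t\|K\|^2}t,$$ then $$G(x_{t+1}^{ag})+F(Kx_{t+1}^{ag})-f^*\le\frac{2L_GD_X^2}{t(t+1)}+\frac1{t+1}\Big[\chi\rho\|K\|^2D_X^2+(1-\chi)\rho D_{X,K}^2+\frac{D_Y^2}\rho\Big].$$ In particular, if $\rho$ is given by $\rho=\dfrac{D_Y}{\chi\|K\|D_X+(1-\chi)D_{X,K}}$, then $$G(x_{t+1}^{ag})+F(Kx_{t+1}^{ag})-f^*\le\frac{2L_GD_X^2}{t(t+1)}+\frac2{t+1}\big[\chi\|K\|D_XD_Y+(1-\chi)D_{X,K}D_Y\big].$$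
   Context: $\mathcal W,\mathcal X,\mathcal Y$ are finite-dimensional vector spaces equipped with inner product $\langle\cdot,\cdot\rangle$, norm $\|\cdot\|$ and conjugate norm $\|\cdot\|_*$; $X\subseteq\mathcal X$ is a closed convex set; $G:X\to\mathbb R$ and $F:\mathcal W\to\mathbb R$ are finite-valued, convex and lower semicontinuous; $F^*(u)=\sup_{w}\langle u,w\rangle-F(w)$ is the convex conjugate of $F$ and $\operatorname{dom}F^*=\{u:F^*(u)<\infty\}$; $K:\mathcal X\to\mathcal Y$ and $B:\mathcal W\to\mathcal Y$ are bounded linear operators, $\|K\|$ is the operator norm; $b\in\mathcal Y$. $G$ is continuously differentiable and there is $L_G>0$ with $G(x_2)-G(x_1)-\langle\nabla G(x_1),x_2-x_1\rangle\le\frac{L_G}{2}\|x_2-x_1\|^2$ for all $x_1,x_2\in X$. Problem: minimize $G(x)+F(w)$ over $x\in X$, $w\in\mathcal W$ subject to $Bw-Kx=b$ (when $B=I,b=0$ this is $\min_{x\in X}G(x)+F(Kx)$). It is assumed that there is an optimal solution $(w^*,x^* )$ and $y^*\in\mathcal Y$ such that $(w^*,x^*,y^* )$ is a saddle point of $\min_{x\in X,w\in\mathcal W}\max_{y\in\mathcal Y}G(x)+F(w)-\langle y,Bw-Kx-b\rangle$. $f^*:=G(x^* )+F(w^* )$ is the optimal value. Constants: $D_S:=\sup_{s_1,s_2\in S}\|s_1-s_2\|$ for a compact set $S$; $D_{X,K}:=\sup_{u_1,u_2\in X}\|Ku_1-Ku_2\|$. AADMM algorithm. $\chi\in\{0,1\}$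 is a binary constant; $\alpha_t,\theta_t,\tau_t,\rho_t,\eta_t$ are parameters. Choose $x_1\in X$, $w_1\in\mathcal W$ with $Bw_1=Kx_1+b$; set $x_1^{ag}=x_1$, $w_1^{ag}=w_1$, $y_1^{ag}=y_1=0$. For $t=1,\dots,N-1$: $$\begin{aligned}x_t^{md}&=(1-\alpha_t)x_t^{ag}+\alpha_tx_t,\\ x_{t+1}&=\operatorname*{argmin}_{x\in X}\ \langle\nabla G(x_t^{md}),x\rangle-\chi\theta_t\langle Bw_t-Kx_t-b,Kx\rangle+\tfrac{(1-\chi)\theta_t}2\|Bw_t-Kx-b\|^2+\langle y_t,Kx\rangle+\tfrac{\eta_t}2\|x-x_t\|^2,\\ x_{t+1}^{ag}&=(1-\alpha_t)x_t^{ag}+\alpha_tx_{t+1},\\ w_{t+1}&=\operatorname*{argmin}_{w\in\mathcal W}\ F(w)-\langle y_t,Bw\rangle+\tfrac{\tau_t}2\|Bw-Kx_{t+1}-b\|^2,\\ w_{t+1}^{ag}&=(1-\alpha_t)w_t^{ag}+\alpha_tw_{t+1},\\ y_{t+1}&=y_t-\rho_t(Bw_{t+1}-Kx_{t+1}-b),\\ y_{t+1}^{ag}&=(1-\alpha_t)y_t^{ag}+\alpha_ty_{t+1}.\end{aligned}$$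
   Formalization: The formal statement additionally assumes 0 ∈ dom F* (the initial multiplier y_1 = 0 lies in Y), without which the bound fails (e.g. F(w) = cw with c large), and takes each norm to be the one induced by the inner product, since the bound fails for unrelated norms. *)

(* Defs.v *)
From HB Require Import structures.
From mathcomp Require Import all_boot all_order all_algebra.
From mathcomp Require Import sesquilinear.
From mathcomp Require Import all_classical all_reals all_analysis.

Set Implicit Arguments.
Unset Strict Implicit.
Unset Printing Implicit Defensive.

Import Order.TTheory GRing.Theory Num.Theory.
Import numFieldNormedType.Exports.

Local Open Scope classical_set_scope.
Local Open Scope ring_scope.

(* Finite-dimensional real inner product spaces, normed by the inner product
   (so that the norm is its own conjugate norm). *)
HB.mixin Record isEuclidean (R : realType) V
    & NormedModule R V & Vector R V := {
  inner : {dot V for (@idfun R)} ;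
  sqr_normE : forall v : V, `|v| ^+ 2 = inner v v
}.

#[short(type="euclideanType")]
HB.structure Definition Euclidean (R : realType) :=
  { V of NormedModule R V & Vector R V & isEuclidean R V }.

Notation "''[' u , v ]" := (inner u v) : ring_scope.

Section convex_analysis.
Context {R : realType}.

Definition is_argmin (T : Type) (A : set T) (f : T -> R) (x : T) : Prop :=
  A x /\ forall z, A z -> f x <= f z.

Definition conjugate (W : euclideanType R) (F : W -> R) (u : W) : \bar R :=
  ereal_sup [set ('[u, w] - F w)%:E | w in [set: W]].

Definition dom_conjugate (W : euclideanType R) (F : W -> R) : set W :=
  [set u | (conjugate F u < +oo)%E].

Definition diam (V : normedModType R) (S : set V) : R :=
  sup [set `|s1 - s2| | s1 in S & s2 in S].

Definition diam_image (V U : normedModType R) (S : set V) (K : V -> U) : R :=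
  sup [set `|K u1 - K u2| | u1 in S & u2 in S].

Definition opnorm (V U : normedModType R) (K : V -> U) : R :=
  sup [set `|K x| | x in [set x | `|x| <= 1]].

(* G is only meaningful on X: difference quotients are taken inside X, and g is
   any gradient field for them (it is unique when X has nonempty interior; in
   general only its products with the differences of points of X are). *)
Definition is_gradient_on (V : euclideanType R) (X : set V)
    (G : V -> R) (g : V -> V) : Prop :=
  forall x, X x ->
    (G x' - G x - '[g x, x' - x]) / `|x' - x| @[x' --> within X x^'] --> (0 : R).

Definition continuously_differentiable_on (V : euclideanType R) (X : set V)
    (G : V -> R) (g : V -> V) : Prop :=
  is_gradient_on X G g /\ {within X, continuous g}.

Definition lower_semicontinuous_on (V : euclideanType R) (X : set V)
    (G : V -> R) : Prop :=
  lower_semicontinuous (fun x : subspace X => (G x)%:E).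

End convex_analysis.

Section problem.
Context {R : realType} {W V Y : euclideanType R}.
Variables (X : set V) (G : V -> R) (F : W -> R).
Variables (K : {linear V -> Y}) (B : {linear W -> Y}) (b : Y).

Definition is_optimal (w0 : W) (x0 : V) : Prop :=
  is_argmin [set p : W * V | X p.2 /\ B p.1 - K p.2 = b]
            (fun p => G p.2 + F p.1) (w0, x0).

Definition lagrangian (w : W) (x : V) (y : Y) : R :=
  G x + F w - '[y, B w - K x - b].

Definition is_saddle_point (w0 : W) (x0 : V) (y0 : Y) : Prop :=
  [/\ X x0,
      forall y, lagrangian w0 x0 y <= lagrangian w0 x0 y0 &
      forall w x, X x -> lagrangian w0 x0 y0 <= lagrangian w x y0].

Record AADMM (gradG : V -> V) (chi : bool) (N : nat)
    (alpha theta tau rho eta : nat -> R)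
    (xmd x xag : nat -> V) (w wag : nat -> W) (y yag : nat -> Y) : Prop := {
  AADMM_x1 : X (x 1) ;
  AADMM_w1 : B (w 1) = K (x 1) + b ;
  AADMM_y1 : y 1 = 0 ;
  AADMM_xag1 : xag 1 = x 1 ;
  AADMM_wag1 : wag 1 = w 1 ;
  AADMM_yag1 : yag 1 = y 1 ;
  AADMM_xmd : forall t, (1 <= t < N)%N ->
    xmd t = (1 - alpha t) *: xag t + alpha t *: x t ;
  AADMM_x : forall t, (1 <= t < N)%N ->
    is_argmin X (fun z =>
        '[gradG (xmd t), z]
        - chi%:R * theta t * '[B (w t) - K (x t) - b, K z]
        + (1 - chi%:R) * theta t / 2 * `|B (w t) - K z - b| ^+ 2
        + '[y t, K z]
        + eta t / 2 * `|z - x t| ^+ 2)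
      (x t.+1) ;
  AADMM_xag : forall t, (1 <= t < N)%N ->
    xag t.+1 = (1 - alpha t) *: xag t + alpha t *: x t.+1 ;
  AADMM_w : forall t, (1 <= t < N)%N ->
    is_argmin [set: W] (fun v =>
        F v - '[y t, B v] + tau t / 2 * `|B v - K (x t.+1) - b| ^+ 2)
      (w t.+1) ;
  AADMM_wag : forall t, (1 <= t < N)%N ->
    wag t.+1 = (1 - alpha t) *: wag t + alpha t *: w t.+1 ;
  AADMM_y : forall t, (1 <= t < N)%N ->
    y t.+1 = y t - rho t *: (B (w t.+1) - K (x t.+1) - b) ;
  AADMM_yag : forall t, (1 <= t < N)%N ->
    yag t.+1 = (1 - alpha t) *: yag t + alpha t *: y t.+1
}.

End problem.

(* Main.v *)
Require Import Defs.
From HB Require Import structures.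
From mathcomp Require Import all_boot all_order all_algebra.
From mathcomp Require Import sesquilinear.
From mathcomp Require Import all_classical all_reals all_analysis.
From mathcomp Require Import ring lra.

Set Implicit Arguments.
Unset Strict Implicit.
Unset Printing Implicit Defensive.

Import Order.TTheory GRing.Theory Num.Theory.
Import numFieldNormedType.Exports.

Local Open Scope classical_set_scope.
Local Open Scope ring_scope.

(** The rate comes from a weighted telescoping argument.  Fix a multiplier [u]
    in the domain of the conjugate of [F], and let [gap u t] be the Lagrangian
    at the averaged iterates [xag t], [wag t] and at [u], minus the optimal
    value.  One iteration contracts this gap by [1 - alpha t] up to [alpha t]
    times terms that are quadratic in the iterates ([gap_step]).  Three facts
    give this: the accelerated descent estimate for [G]
    ([accelerated_gradient_step]), the optimality of the [x]-update tested at
    the solution ([argmin_first_order]), and the fact that, because the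
    penalty and the dual step are the same number [rho], the updated multiplier
    is exactly a subgradient of [F] at the updated [w]
    ([multiplier_subgradient]).  Polarization turns every inner product into a
    difference of squared distances.

    Multiplying by [t (t + 1) / 2] makes [1 - alpha t] turn the weight of step
    [t] into that of step [t - 1], and the choices of [theta] and [eta] make
    the squared distances telescope: each step leaves over a fixed multiple of
    one primal squared distance and of one squared distance between
    multipliers, which the diameters bound.  The invariant is
    [gap_potential_le], and dividing by the weight gives [gap_le].  The
    multipliers must stay within one diameter of [u], which holds because they
    are subgradients (or the initial value [0]), hence in the domain of the
    conjugate.

    It remains to replace [F (wag t)] by [F (K (xag t))], since the averaged
    iterates need not be feasible.  If [u] is a subgradient of [F] at [K (xag t)],
    then [F (K (xag t))] is at most [F (wag t)] minus the inner product of [u]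
    with the residual, so the objective error is at most [gap u t]
    ([objective_le_gap]).  Such a [u] exists because [F] is finite and convex
    on a finite-dimensional space ([exists_subgradient]). *)

(** * Inner product spaces *)

Section inner_product.
Context {R : realType} {V : euclideanType R}.
Implicit Types u v z : V.

Lemma innerC u v : '[u, v] = '[v, u].
Proof. by rewrite (hermC (inner : {dot V for idfun})) expr0 mul1r. Qed.

Lemma innerDl u v z : '[u + v, z] = '[u, z] + '[v, z].
Proof. by rewrite linearDl. Qed.

Lemma innerDr u v z : '[z, u + v] = '[z, u] + '[z, v].
Proof. by rewrite linearDr. Qed.

Lemma innerBl u v z : '[u - v, z] = '[u, z] - '[v, z].
Proof. by rewrite linearBl. Qed.

Lemma innerBr u v z : '[z, u - v] = '[z, u] - '[z, v].
Proof. by rewrite linearBr. Qed.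

Lemma innerZl a u z : '[a *: u, z] = a * '[u, z].
Proof. by rewrite linearZl_LR. Qed.

Lemma innerZr a u z : '[z, a *: u] = a * '[z, u].
Proof. by rewrite linearZ. Qed.

Lemma inner0r z : '[z, 0] = 0.
Proof. by rewrite linear0r. Qed.

Definition innerE := (innerBl, innerBr, innerDl, innerDr, innerZl, innerZr).

(** The map sending a vector to its products with a basis of [U] has too small a
    codomain to be injective; a nonzero vector of its kernel is orthogonal to
    [U]. *)
Lemma exists_orthogonal (U : {vspace V}) :
  (\dim U < \dim {:V})%N ->
  exists2 d : V, d != 0 & forall h, h \in U -> '[h, d] = 0.
Proof.
move=> ltU.
pose f (z : V) : 'rV[R]_(\dim U) := \row_i '[(vbasis U)`_i, z].
have flin : linear f.
  by move=> a u v; apply/rowP => i; rewrite !mxE innerDr innerZr.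
pose fL := HB.pack_for {linear V -> 'rV[R]_(\dim U)} f
  (GRing.isLinear.Build _ _ _ _ f flin).
have ker_gt0 : (0 < \dim (lker (linfun fL)))%N.
  have := limg_ker_dim (linfun fL) fullv; rewrite capfv => e.
  have : (\dim (limg (linfun fL)) <= \dim U)%N.
    by rewrite (leq_trans (dimvS (subvf _)))// dimvf /dim/= mul1n.
  move=> le_img; rewrite lt0n; apply/negP => /eqP ker0.
  by move: ltU; rewrite -e ker0 add0n ltnNge le_img.
exists (vpick (lker (linfun fL))).
  by rewrite vpick0 -dimv_eq0 -lt0n.
have := memv_pick (lker (linfun fL)).
rewrite memv_ker lfunE /= => /eqP fd0 h hU.
rewrite (coord_vbasis hU) linear_sumlz big1// => i _.
apply: etrans (innerZl _ _ _) _; move/rowP: fd0 => /(_ i); rewrite !mxE => ->.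
exact: mulr0.
Qed.

Lemma sqr_normDZ (p q : V) (s : R) :
  `|p + s *: q| ^+ 2 = `|p| ^+ 2 + s * (2 * '[p, q]) + s ^+ 2 * `|q| ^+ 2.
Proof. by rewrite !sqr_normE !innerE (innerC q p); ring. Qed.

(** Polarization in the form that makes the estimates telescope: the right-hand
    side consists of squared distances only. *)
Lemma four_point (a b c d : V) :
  '[a - b, c - d] =
  (`|a - d| ^+ 2 + `|b - c| ^+ 2 - `|a - c| ^+ 2 - `|b - d| ^+ 2) / 2.
Proof.
rewrite !sqr_normE !innerE (innerC c a) (innerC d a) (innerC c b) (innerC d b).
by field.
Qed.

Lemma diam_ge (S : set V) s1 s2 : compact S -> S s1 -> S s2 ->
  `|s1 - s2| <= diam S.
Proof.
move=> /compact_bounded [M [_ MS]] S1 S2.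
apply: ub_le_sup; last by exists s1 => //; exists s2.
exists ((M + 1) + (M + 1)) => _ [a Sa [b Sb <-]].
have bd c : S c -> `|c| <= M + 1 by apply: MS; rewrite ltrDl.
by rewrite (le_trans (ler_normB _ _))// lerD ?bd.
Qed.

End inner_product.

(** * Convex functions and subgradients *)

Section convexity.
Context {R : realType} {V : euclideanType R}.

Lemma convex_setP (X : set V) : convex_set X ->
  forall x z s, X x -> X z -> 0 <= s -> s <= 1 -> X ((1 - s) *: x + s *: z).
Proof.
move=> cX x z s Xx Xz s0 s1.
rewrite addrC.
exact: set_mem (cX z x (Itv01 s0 s1) (mem_set Xz) (mem_set Xx)).
Qed.

Lemma convex_functionP (X : set V) (f : V -> R) : convex_function X f ->
  forall x z s, X x -> X z -> 0 <= s -> s <= 1 ->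
    f ((1 - s) *: x + s *: z) <= (1 - s) * f x + s * f z.
Proof.
move=> cf x z s Xx Xz s0 s1.
rewrite [X in f X]addrC [leRHS]addrC.
exact: cf (Itv01 s0 s1) z x (mem_set Xz) (mem_set Xx).
Qed.

(** Dividing by [s] and letting [s] tend to [0]; this extracts first-order
    optimality conditions from minimality along a segment. *)
Lemma first_order_ge0 (a b : R) :
  (forall s, 0 < s -> s <= 1 -> 0 <= s * a + s ^+ 2 * b) -> 0 <= a.
Proof.
move=> H; rewrite leNgt; apply/negP => a0.
have d0 : 0 < 1 + `|b| by rewrite ltr_pwDl.
have dNa : 0 < - a + (1 + `|b|) by rewrite addr_gt0// oppr_gt0.
(* [s] lies in ]0, 1[ and is small enough for [s |b|] to stay below [- a]. *)
pose s := - a / (- a + (1 + `|b|)).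
have s0 : 0 < s by rewrite divr_gt0// oppr_gt0.
have s1 : s <= 1 by rewrite ler_pdivrMr// mul1r lerDl ltW.
have := H s s0 s1; rewrite expr2 -mulrA -mulrDr pmulr_rge0//.
apply/negP; rewrite -ltNge.
have bb : s * b <= s * `|b| by rewrite ler_pM2l// ler_norm.
have e : s * (- a + (1 + `|b|)) = - a by rewrite divfK// gt_eqF.
have : 0 < s * (- a + 1) by rewrite mulr_gt0// addr_gt0// oppr_gt0.
by move: bb e; rewrite !mulrDr; lra.
Qed.

Definition subgradient (f : V -> R) (v u : V) :=
  forall z, f v + '[u, z - v] <= f z.

Lemma subgradient_dom_conjugate (f : V -> R) (v u : V) :
  subgradient f v u -> dom_conjugate f u.
Proof.
move=> fu; apply: (@le_lt_trans _ _ ('[u, v] - f v)%:E); last exact: ltry.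
apply: ge_ereal_sup => _ [z _ <-]; rewrite lee_fin.
by have := fu z; rewrite innerBr; lra.
Qed.

(** The one-dimensional step of the Hahn-Banach theorem.  As [d] is orthogonal to
    [U], adding a multiple of [d] to [u] changes its product with [d] to any
    prescribed slope without changing its products with [U].  A slope is
    admissible if it lies above all the lower bounds coming from the side of
    [- d] and below all the upper bounds coming from the side of [d]; convexity
    of [f] between one point of each side shows that every lower bound is at
    most every upper bound, so the supremum of the lower bounds works. *)
Lemma subgradient_extend (f : V -> R) (v u d : V) (U : {vspace V}) :
  convex_function [set: V] f -> d != 0 -> (forall h, h \in U -> '[h, d] = 0) ->
  (forall h, h \in U -> f v + '[u, h] <= f (v + h)) ->
  exists u', forall h, h \in (U + <[d]>)%VS -> f v + '[u', h] <= f (v + h).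
Proof.
move=> cf d0 Ud Uu.
have dd : 0 < '[d, d] by rewrite -sqr_normE exprn_gt0// normr_gt0.
pose lo := [set (f v + '[u, p.1] - f (v + p.1 - p.2 *: d)) / p.2 | p in
             [set p : V * R | p.1 \in U /\ 0 < p.2]].
have lo_le h r : h \in U -> 0 < r ->
    ubound lo ((f (v + h + r *: d) - f v - '[u, h]) / r).
  move=> hU r0 _ [[k q] /= [kU q0] <-].
  rewrite ler_pdivlMr// mulrAC ler_pdivrMr//.
  have qr0 : 0 < q + r by rewrite addr_gt0.
  (* The weights for which the displacements along [d] cancel. *)
  have s0 : 0 <= q / (q + r) by rewrite divr_ge0// ltW.
  have s1 : q / (q + r) <= 1 by rewrite ler_pdivrMr// mul1r lerDl ltW.
  have := convex_functionP cf (x := v + k - q *: d) (z := v + h + r *: d) I I s0 s1.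
  have -> : 1 - q / (q + r) = r / (q + r) by field; rewrite gt_eqF.
  have -> : (r / (q + r)) *: (v + k - q *: d) + (q / (q + r)) *: (v + h + r *: d)
      = v + ((r / (q + r)) *: k + (q / (q + r)) *: h).
    have aq : r / (q + r) * q = q / (q + r) * r by ring.
    have ac : r / (q + r) + q / (q + r) = 1 by field; rewrite gt_eqF.
    rewrite !scalerDr scalerN !scalerA aq addrACA addNr addr0 addrACA.
    by rewrite -scalerDl ac scale1r.
  have := Uu ((r / (q + r)) *: k + (q / (q + r)) *: h).
  rewrite memvD ?memvZ// => /(_ isT) + H.
  move=> /le_trans /(_ H); rewrite innerDr !innerZr -(ler_pM2l qr0).
  have Eq a b : (q + r) * (r / (q + r) * a + q / (q + r) * b) = r * a + q * b.
    by field; rewrite gt_eqF.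
  by rewrite mulrDr !Eq; lra.
have lo0 : lo !=set0.
  by exists ((f v + '[u, 0] - f (v + 0 - 1 *: d)) / 1), (0, 1) => //=; rewrite mem0v.
pose s := sup lo.
have hslo h q : h \in U -> 0 < q -> f v + '[u, h] - q * s <= f (v + h - q *: d).
  move=> hU q0.
  have : (f v + '[u, h] - f (v + h - q *: d)) / q <= s.
    apply: ub_le_sup; last by exists (h, q).
    by exists ((f (v + 0 + 1 *: d) - f v - '[u, 0]) / 1); apply: lo_le; rewrite ?mem0v.
  by rewrite ler_pdivrMr//; lra.
have hshi h r : h \in U -> 0 < r -> f v + '[u, h] + r * s <= f (v + h + r *: d).
  move=> hU r0.
  have : s <= (f (v + h + r *: d) - f v - '[u, h]) / r.
    by apply: ge_sup => //; exact: lo_le.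
  by rewrite ler_pdivlMr//; lra.
exists (u + ((s - '[u, d]) / '[d, d]) *: d) => _ /memv_addP[h hU [_ /vlineP[r ->] ->]].
have -> : '[u + ((s - '[u, d]) / '[d, d]) *: d, h + r *: d] = '[u, h] + r * s.
  by rewrite !innerE (innerC d h) (Ud h hU); field; rewrite gt_eqF.
have [r0|r0|->] := ltgtP r 0.
- have := hslo h (- r) hU; rewrite oppr_gt0 => /(_ r0).
  by rewrite scaleNr opprK mulNr opprK !addrA.
- by rewrite !addrA; exact: hshi.
- by rewrite mul0r scale0r !addr0; exact: Uu.
Qed.

(** Starting from the zero subspace, on which any vector is a subgradient, the
    domain is enlarged one orthogonal direction at a time. *)
Lemma exists_subgradient (f : V -> R) (v : V) :
  convex_function [set: V] f -> exists u, subgradient f v u.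
Proof.
move=> cf.
suff: forall k, (k <= \dim {:V})%N -> exists (U : {vspace V}) u,
    (k <= \dim U)%N /\ forall h, h \in U -> f v + '[u, h] <= f (v + h).
  move=> /(_ _ (leqnn _))[U [u [dU Uu]]]; exists u => z.
  have -> : z = v + (z - v) by rewrite addrC subrK.
  have -> : v + (z - v) - v = z - v by rewrite addrC addKr.
  by apply: Uu; rewrite (_ : U = fullv) ?memvf//; apply/eqP; rewrite eqEdim subvf.
elim=> [_|k IH kV].
  exists 0%VS, 0; split=> // h; rewrite memv0 => /eqP ->.
  by rewrite inner0r !addr0.
have [U [u [kU Uu]]] := IH (ltnW kV).
have [kU'|Uk] := ltnP k (\dim U); first by exists U, u.
have [d d0 Ud] := exists_orthogonal (leq_ltn_trans Uk kV).
have [u' Uu'] := subgradient_extend cf d0 Ud Uu.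
exists (U + <[d]>)%VS, u'; split=> //.
rewrite (leq_ltn_trans kU)// ltnNge; apply/negP => le.
have eU : U = (U + <[d]>)%VS by apply/eqP; rewrite eqEdim addvSl.
have dU : d \in U.
  by rewrite eU; apply: (subvP (addvSr _ _)); rewrite memv_line.
have := Ud d dU; move/eqP; rewrite -sqr_normE expf_eq0/= normr_eq0.
by rewrite (negPf d0).
Qed.

End convexity.

(** * Compact sets, linear maps and first-order conditions *)

Section first_order.
Context {R : realType} {V W : euclideanType R}.

Lemma opnorm_ge (K : {linear V -> W}) v : bounded_fun_norm K ->
  `|K v| <= opnorm K * `|v|.
Proof.
move=> /(_ 1)[M bK].
have [->|v0] := eqVneq v 0; first by rewrite linear0 !normr0 mulr0.
rewrite -ler_pdivrMr ?normr_gt0//.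
have -> : `|K v| / `|v| = `|K (`|v|^-1 *: v)|.
  by rewrite linearZ normrZ normfV normr_id mulrC.
apply: ub_le_sup; first by exists M => _ [z /= z1 <-]; exact: bK.
by exists (`|v|^-1 *: v) => //=; rewrite normrZ normfV normr_id mulVf// normr_eq0.
Qed.

Lemma diam_image_ge (K : {linear V -> W}) (S : set V) s1 s2 :
  bounded_fun_norm K -> compact S -> S s1 -> S s2 ->
  `|K s1 - K s2| <= diam_image S K.
Proof.
move=> bK cS S1 S2; apply: ub_le_sup; last by exists s1 => //; exists s2.
have [M KM] := bK (diam S).
by exists M => _ [a Sa [b Sb <-]]; rewrite -linearB KM// diam_ge.
Qed.

(** The relative gradient controls the difference quotients inside [X] only, which
    is enough: the segment from [x] to [z] stays in [X], and along it the
    quotients of the convex [G] are at most the slope of the chord, while they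
    converge to the slope of the linearization. *)
Lemma convex_gradient_le (X : set V) (G : V -> R) (g : V -> V) x z :
  convex_set X -> convex_function X G -> is_gradient_on X G g ->
  X x -> X z -> G x + '[g x, z - x] <= G z.
Proof.
move=> cX cG gG Xx Xz.
have [->|zx] := eqVneq z x; first by rewrite subrr inner0r addr0.
have zx0 : 0 < `|z - x| by rewrite normr_gt0 subr_eq0.
rewrite leNgt; apply/negP => lt.
pose e := (G x + '[g x, z - x] - G z) / `|z - x|.
have e0 : 0 < e by rewrite divr_gt0// subr_gt0.
have := gG x Xx => /cvgr0Pnorm_lt /(_ e e0).
move=> /nbhs_ballP[/= r r0 Hr].
(* A step along the segment that stays in the ball of radius [r]. *)
pose s := Num.min 1 (r / 2 / `|z - x|).
have s0 : 0 < s by rewrite lt_min ltr01 !divr_gt0.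
have s1 : s <= 1 by rewrite ge_min lexx.
have sr : s * `|z - x| < r.
  rewrite (@le_lt_trans _ _ (r / 2))//; last by rewrite ltr_pdivrMr// ltr_pMr// ltr1n.
  by rewrite -ler_pdivlMr// ge_min lexx orbT.
pose x' := (1 - s) *: x + s *: z.
have x'E : x' - x = s *: (z - x).
  by rewrite /x' scalerBl scale1r scalerBr addrAC (addrAC x) subrr sub0r addrC.
have nx' : `|x' - x| = s * `|z - x| by rewrite x'E normrZ gtr0_norm.
have Xx' : X x' by apply: convex_setP => //; exact: ltW.
have := Hr x'; rewrite -ball_normE /= distrC nx' => /(_ sr).
rewrite -subr_eq0 -normr_eq0 nx' mulf_eq0 !gt_eqF// => /(_ isT Xx').
rewrite ltNge ler_normr => /negP; apply; apply/orP; right.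
rewrite x'E innerZr -mulNr /e ler_pdivlMr ?mulr_gt0//.
rewrite mulrACA mulVf ?gt_eqF// mulr1.
have := convex_functionP cG Xx Xz (ltW s0) s1; rewrite -/x'.
by rewrite mulrC; lra.
Qed.

(** Along a segment from the minimizer the smooth terms contribute their gradient
    at [w] to first order, so the negative of this gradient is a subgradient of
    [F]. *)
Lemma prox_subgradient (F : V -> R) (w k y : V) (tau : R) :
  convex_function [set: V] F ->
  is_argmin [set: V] (fun v => F v - '[y, v] + tau / 2 * `|v - k| ^+ 2) w ->
  subgradient F w (y - tau *: (w - k)).
Proof.
move=> cF [_ wmin] v; rewrite -subr_ge0.
apply: (@first_order_ge0 _ _ (tau / 2 * `|v - w| ^+ 2)) => s s0 s1.
have sE : (1 - s) *: w + s *: v = w + s *: (v - w).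
  by rewrite scalerBl scale1r scalerBr addrAC addrA.
have := convex_functionP cF (x := w) (z := v) I I (ltW s0) s1.
have := wmin ((1 - s) *: w + s *: v) I; rewrite sE.
rewrite [_ + _ - k]addrAC sqr_normDZ innerDr innerZr innerBl innerZl.
by lra.
Qed.

(** The variational inequality of the minimizer [x], tested at [z].  With both
    penalty coefficients free it covers the linearized and the exact treatment
    of the quadratic penalty at once. *)
Lemma argmin_first_order (X : set V) (K : {linear V -> W}) (g x0 x z : V)
    (r r' y : W) (c1 c2 c3 : R) :
  convex_set X ->
  is_argmin X (fun z => '[g, z] - c1 * '[r, K z] + c2 / 2 * `|r' - K z| ^+ 2
     + '[y, K z] + c3 / 2 * `|z - x0| ^+ 2) x ->
  X z ->
  '[g, x - z] <= c1 * '[r, K x - K z] + c2 * '[r' - K x, K x - K z]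
     - '[y, K x - K z] - c3 * '[x - x0, x - z].
Proof.
move=> cX [Xx xmin] Xz; rewrite -subr_ge0.
apply: (@first_order_ge0 _ _ (c2 / 2 * `|K x - K z| ^+ 2 + c3 / 2 * `|x - z| ^+ 2)).
move=> s s0 s1.
have sE : (1 - s) *: x + s *: z = x + (- s) *: (x - z).
  by rewrite scalerBl scale1r scaleNr scalerBr opprB addrA addrAC.
have := xmin _ (convex_setP cX Xx Xz (ltW s0) s1); rewrite sE.
have -> : x + - s *: (x - z) - x0 = x - x0 + - s *: (x - z) by rewrite addrAC.
have -> : K (x + - s *: (x - z)) = K x + - s *: (K x - K z).
  by rewrite linearD linearZ linearB.
have -> : r' - (K x + - s *: (K x - K z)) = r' - K x + s *: (K x - K z).
  by rewrite opprD scaleNr opprK addrA.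
move: (x - z) (K x - K z) => d e.
by rewrite (sqr_normDZ (x - x0)) (sqr_normDZ (r' - K x)) !innerDr !innerZr; lra.
Qed.

End first_order.

(** * Estimates for one iteration *)

(** The coupling terms of a dual ascent step.  Writing [y' = y - rho (w - p)],
    the square of the residual [w - p] that comes from the multipliers cancels
    the one that comes from the primal terms, so that nothing but differences
    of squared distances remains. *)
Lemma dual_step (R : realType) (Y : euclideanType R) (w p wopt y u : Y) (rho : R) :
  rho != 0 ->
  let y' := y - rho *: (w - p) in
  '[y', w - wopt] - '[y, p - wopt] - '[u, w - p] =
  rho / 2 * (`|p - wopt| ^+ 2 - `|w - wopt| ^+ 2)
  + (`|y - u| ^+ 2 - `|y' - u| ^+ 2) / (2 * rho).
Proof.
move=> rho0 /=; rewrite -[in `|_ - rho *: _ - _|]addrA [- _ - u]addrC addrA -scaleNr.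
rewrite sqr_normDZ !sqr_normE !innerE (innerC p w) (innerC wopt w) (innerC wopt p).
by field.
Qed.

(** Averaging damps the quadratic error by [a ^+ 2]: the new average differs from
    the point [xmd] where the gradient is taken by [a *: (x' - x)].  The
    linearization at [xmd] splits along the average, one part being compared
    with [G xag] and the other with [G z]. *)
Lemma accelerated_gradient_step (R : realType) (V : euclideanType R) (X : set V)
    (G : V -> R) (g : V -> V) (L a : R) (xag x x' z : V) :
  convex_set X -> convex_function X G -> is_gradient_on X G g ->
  (forall x1 x2, X x1 -> X x2 ->
    G x2 - G x1 - '[g x1, x2 - x1] <= L / 2 * `|x2 - x1| ^+ 2) ->
  0 <= a -> a <= 1 -> X xag -> X x -> X x' -> X z ->
  forall xmd, xmd = (1 - a) *: xag + a *: x ->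
  G ((1 - a) *: xag + a *: x') - G z <=
  (1 - a) * (G xag - G z) + a * '[g xmd, x' - z]
  + L / 2 * (a ^+ 2 * `|x' - x| ^+ 2).
Proof.
move=> cX cG gG GL a0 a1 Xxag Xx Xx' Xz xmd xmdE.
have Xmd : X xmd by rewrite xmdE; exact: convex_setP.
have Xag' : X ((1 - a) *: xag + a *: x') by exact: convex_setP.
have := GL _ _ Xmd Xag'.
have -> : (1 - a) *: xag + a *: x' - xmd = a *: (x' - x).
  by rewrite xmdE opprD addrACA subrr add0r scalerBr.
rewrite normrZ (ger0_norm a0) exprMn.
have sumE : a *: (x' - x) = (1 - a) *: (xag - xmd) + a *: (x' - xmd).
  rewrite !scalerBr addrACA -opprD -scalerDl subrK scale1r xmdE.
  by rewrite [in RHS]opprD addrACA subrr add0r.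
have zE : x' - z = (x' - xmd) - (z - xmd) by rewrite opprB subrKA.
have := ler_wpM2l (_ : 0 <= 1 - a) (convex_gradient_le cX cG gG Xmd Xxag).
rewrite subr_ge0 => /(_ a1).
have := ler_wpM2l a0 (convex_gradient_le cX cG gG Xmd Xz).
rewrite sumE zE (innerDr ((1 - a) *: _)) !innerZr innerBr.
by lra.
Qed.

(** The recursion of iteration [t] after multiplication by [t (t + 1) / 2], where
    [S] stands for [t - 1] and [c] for the binary switch; the denominators of
    the parameters cancel against the weight, except for the one that the square
    of [alpha t] leaves in the last term. *)
Lemma weighted_step (R : realFieldType)
    (S rho L c k gap0 gap1 i1 i2 i3 p w y0 y1 d : R) :
  0 <= S -> 0 < rho ->
  gap1 <= (1 - 2 / (S + 1 + 1)) * gap0 + 2 / (S + 1 + 1) *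
    (c * ((S + 1 - 1) * rho / (S + 1)) * i1
     + (1 - c) * ((S + 1 - 1) * rho / (S + 1)) * i2
     - (2 * L + c * rho * (S + 1) * k) / (S + 1) * i3
     + rho / 2 * (p - w) + (y0 - y1) / (2 * rho))
    + L / 2 * ((2 / (S + 1 + 1)) ^+ 2 * d) ->
  (S + 1) * (S + 1 + 1) / 2 * gap1 <=
  S * (S + 1) / 2 * gap0 + c * (S * rho * i1) + (1 - c) * (S * rho * i2)
  - (2 * L + c * rho * (S + 1) * k) * i3 + (S + 1) * (rho / 2 * (p - w))
  + (S + 1) * (y0 / (2 * rho) - y1 / (2 * rho)) + L * (S + 1) / (S + 1 + 1) * d.
Proof.
move=> S0 rho0.
have S1 : 0 < S + 1 by rewrite ltr_wpDl.
have S2 : 0 < S + 1 + 1 by rewrite ltr_wpDl// ltW.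
have T0 : 0 <= (S + 1) * (S + 1 + 1) / 2 by rewrite divr_ge0// mulr_ge0// ltW.
move=> /(ler_wpM2l T0) /le_trans; apply; rewrite le_eqVlt; apply/orP; left.
by apply/eqP; field; rewrite !gt_eqF.
Qed.

(** * Telescoping along the iterations *)

Section iterates.
Context {R : realType} {V Y : euclideanType R}.
Context {X : set V} {G : V -> R} {gradG : V -> V} {F : Y -> R}.
Context {K : {linear V -> Y}} {L : R} {ws : Y} {xs : V}.
Context {chi : bool} {N : nat} {rho : R} {alpha theta tau rhos eta : nat -> R}.
Context {xmd x xag : nat -> V} {w wag : nat -> Y} {y yag : nat -> Y}.
Context (convexX : convex_set X) (convexG : convex_function X G)
  (convexF : convex_function [set: Y] F) (boundedK : bounded_fun_norm K)
  (gradGP : is_gradient_on X G gradG) (L_gt0 : 0 < L)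
  (LP : forall x1 x2, X x1 -> X x2 ->
    G x2 - G x1 - '[gradG x1, x2 - x1] <= L / 2 * `|x2 - x1| ^+ 2)
  (Xxs : X xs) (wsE : ws = K xs)
  (compactX : compact X) (compactY : compact (dom_conjugate F))
  (domF0 : dom_conjugate F 0) (rho_gt0 : 0 < rho)
  (run : AADMM X F K (idfun : {linear Y -> Y}) 0 gradG chi N
           alpha theta tau rhos eta xmd x xag w wag y yag)
  (alphaE : forall t, (1 <= t < N)%N -> alpha t = 2 / (t%:R + 1))
  (tauE : forall t, (1 <= t < N)%N -> tau t = rho)
  (rhosE : forall t, (1 <= t < N)%N -> rhos t = rho)
  (thetaE : forall t, (1 <= t < N)%N -> theta t = (t%:R - 1) * rho / t%:R)
  (etaE : forall t, (1 <= t < N)%N ->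
    eta t = (2 * L + chi%:R * rho * t%:R * opnorm K ^+ 2) / t%:R).

Lemma alpha_ge0 t : (1 <= t < N)%N -> 0 <= alpha t.
Proof. by move=> tN; rewrite alphaE// divr_ge0// addr_ge0. Qed.

Lemma alpha_le1 t : (1 <= t < N)%N -> alpha t <= 1.
Proof.
move=> /[dup] tN /andP[t1 _]; rewrite alphaE// ler_pdivrMr ?ltr_wpDl//.
by rewrite mul1r (_ : 2 = 1 + 1)// lerD// ler1n.
Qed.

Lemma multiplierE t : (1 <= t < N)%N ->
  y t.+1 = y t - rho *: (w t.+1 - K (x t.+1)).
Proof. by move=> tN; rewrite (AADMM_y run tN) rhosE// subr0. Qed.

(** The subgradient that the [w]-update provides is the updated multiplier itself,
    because [tau t] and [rhos t] coincide. *)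
Lemma multiplier_subgradient t : (1 <= t < N)%N ->
  subgradient F (w t.+1) (y t.+1).
Proof.
move=> tN; rewrite multiplierE//; apply: prox_subgradient => //.
have := AADMM_w run tN; rewrite tauE//; congr is_argmin.
by apply/funext => v; rewrite subr0.
Qed.

Lemma iterates_feasible s : (s < N)%N ->
  [/\ X (x s.+1), X (xag s.+1) & dom_conjugate F (y s.+1)].
Proof.
elim: s => [_|s IH sN].
  by rewrite (AADMM_xag1 run) (AADMM_y1 run); split=> //; exact: (AADMM_x1 run).
have tN : (1 <= s.+1 < N)%N by [].
have [Xx Xag _] := IH (ltnW sN).
have [Xx' _] := AADMM_x run tN.
split=> //; last exact: subgradient_dom_conjugate (multiplier_subgradient tN).
by rewrite (AADMM_xag run tN); apply: convex_setP => //; [exact: alpha_ge0|exact: alpha_le1].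
Qed.

(** The value of the Lagrangian at the averaged iterates and the multiplier [u],
    relative to the optimal value. *)
Definition gap u t :=
  G (xag t) + F (wag t) - '[u, wag t - K (xag t)] - (G xs + F ws).

Lemma gap_step u t : (1 <= t < N)%N ->
  gap u t.+1 <= (1 - alpha t) * gap u t + alpha t *
    (chi%:R * theta t * '[w t - K (x t), K (x t.+1) - ws]
     + (1 - chi%:R) * theta t * '[w t - K (x t.+1), K (x t.+1) - ws]
     - eta t * '[x t.+1 - x t, x t.+1 - xs]
     + rho / 2 * (`|K (x t.+1) - ws| ^+ 2 - `|w t.+1 - ws| ^+ 2)
     + (`|y t - u| ^+ 2 - `|y t.+1 - u| ^+ 2) / (2 * rho))
  + L / 2 * (alpha t ^+ 2 * `|x t.+1 - x t| ^+ 2).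
Proof.
move=> tN; have [t0 tN'] := andP tN.
have [Xx Xag _] : [/\ X (x t), X (xag t) & dom_conjugate F (y t)].
  by rewrite -(prednK t0); apply: iterates_feasible; rewrite (leq_ltn_trans (leq_pred _)).
have [Xx' _ _] := iterates_feasible tN'.
have a0 := alpha_ge0 tN; have a1 := alpha_le1 tN.
have hG := accelerated_gradient_step convexX convexG gradGP LP a0 a1 Xag Xx Xx' Xxs
  (AADMM_xmd run tN).
have hF : F (wag t.+1) <= (1 - alpha t) * F (wag t) + alpha t * F (w t.+1).
  by rewrite (AADMM_wag run tN); exact: (convex_functionP convexF).
have hFw := multiplier_subgradient tN ws.
have hx : '[gradG (xmd t), x t.+1 - xs] <=
    chi%:R * theta t * '[w t - K (x t), K (x t.+1) - K xs]
    + (1 - chi%:R) * theta t * '[w t - K (x t.+1), K (x t.+1) - K xs]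
    - '[y t, K (x t.+1) - K xs] - eta t * '[x t.+1 - x t, x t.+1 - xs].
  apply: argmin_first_order convexX _ Xxs.
  have := AADMM_x run tN; congr is_argmin.
  by apply/funext => v; rewrite !subr0.
have hD := dual_step (w t.+1) (K (x t.+1)) ws (y t) u (lt0r_neq0 rho_gt0).
rewrite /= -multiplierE// in hD.
have hu : '[u, wag t.+1 - K (xag t.+1)] =
    (1 - alpha t) * '[u, wag t - K (xag t)] + alpha t * '[u, w t.+1 - K (x t.+1)].
  have Kag p q : K ((1 - alpha t) *: p + alpha t *: q) =
      (1 - alpha t) *: K p + alpha t *: K q by rewrite linearD !linearZ.
  rewrite (AADMM_wag run tN) (AADMM_xag run tN) Kag.
  by rewrite !innerE; ring.
rewrite -wsE in hx; rewrite -[ws - _]opprB -scaleN1r innerZr mulN1r in hFw.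
rewrite /gap hu.
rewrite -(AADMM_xag run tN) in hG.
have hFwa := ler_wpM2l a0 hFw; have hxa := ler_wpM2l a0 hx.
move: (congr1 (fun z => alpha t * z) hD); lra.
Qed.

(** The invariant, indexed so that [s = 0] is the starting point, where only the
    term in [L] is left.  When [chi] holds, the distance from [K (x s.+1)] to
    [ws] has the unfavourable sign; it is kept on the right because it
    telescopes, and because in the end the term in [|x s.+1 - xs|] on the left
    absorbs it. *)
Lemma gap_potential_le u s : dom_conjugate F u -> (s < N)%N ->
  s%:R * (s%:R + 1) / 2 * gap u s.+1
  + s%:R * rho / 2 * `|w s.+1 - ws| ^+ 2
  + (L + chi%:R * rho * s%:R * opnorm K ^+ 2 / 2) * `|x s.+1 - xs| ^+ 2
  + s%:R * (`|y s.+1 - u| ^+ 2 / (2 * rho)) <=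
  L * diam X ^+ 2
  + s%:R / 2 * (chi%:R * rho * opnorm K ^+ 2 * diam X ^+ 2
      + (1 - chi%:R) * rho * diam_image X K ^+ 2
      + diam (dom_conjugate F) ^+ 2 / rho)
  + chi%:R * (s%:R * rho / 2) * `|K (x s.+1) - ws| ^+ 2.
Proof.
move=> Fu; elim: s => [|s IH] sN.
  have [Xx _ _] := iterates_feasible sN.
  rewrite !(mulr0, mul0r) !addr0 !add0r ler_pM2l// lerXn2r ?nnegrE//.
  - exact: le_trans (normr_ge0 _) (diam_ge compactX Xx Xx).
  - exact: diam_ge.
have tN : (1 <= s.+1 < N)%N by [].
have [Xx _ Fy] := iterates_feasible (ltnW sN).
have [Xx' _ _] := iterates_feasible sN.
have rho2 : 0 <= rho / 2 by rewrite divr_ge0// ltW.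
have sqr_le (a b : R) : 0 <= a -> a <= b -> a ^+ 2 <= b ^+ 2.
  by move=> a0 ab; rewrite lerXn2r// nnegrE// (le_trans a0).
have hy : `|y s.+1 - u| ^+ 2 / (2 * rho) <= diam (dom_conjugate F) ^+ 2 / (2 * rho).
  by rewrite ler_pM2r ?invr_gt0 ?mulr_gt0// sqr_le// diam_ge.
have hk : rho / 2 * `|K (x s.+2) - ws| ^+ 2 <= rho / 2 * diam_image X K ^+ 2.
  by rewrite ler_wpM2l// sqr_le// wsE diam_image_ge.
have hx : rho / 2 * (opnorm K ^+ 2 * `|x s.+1 - xs| ^+ 2) <=
    rho / 2 * (opnorm K ^+ 2 * diam X ^+ 2).
  by rewrite !ler_wpM2l ?sqr_ge0// sqr_le// diam_ge.
have hKd : rho / 2 * `|K (x s.+1) - K (x s.+2)| ^+ 2 <=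
    rho / 2 * (opnorm K ^+ 2 * `|x s.+1 - x s.+2| ^+ 2).
  by rewrite ler_wpM2l// -exprMn sqr_le// -linearB opnorm_ge.
have hd0 : 0 <= rho / 2 * (opnorm K ^+ 2 * `|x s.+1 - x s.+2| ^+ 2).
  by rewrite mulr_ge0// mulr_ge0 ?sqr_ge0.
have hw0 : 0 <= s%:R * (rho / 2 * `|w s.+1 - K (x s.+2)| ^+ 2).
  by rewrite mulr_ge0// mulr_ge0 ?sqr_ge0.
have hKds := ler_wpM2l (ler0n R s) hKd.
have := IH (ltnW sN); have := gap_step u tN.
rewrite alphaE// thetaE// etaE// -(natr1 s).
move: (s%:R) (ler0n R s) hKds hw0 => S S0 hKds hw0.
have S1 : 0 < S + 1 by rewrite ltr_wpDl.
have S2 : 0 < S + 1 + 1 by rewrite ltr_wpDl// ltW.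
have hL : L * (S + 1) / (S + 1 + 1) * `|x s.+1 - x s.+2| ^+ 2 <=
    L * `|x s.+1 - x s.+2| ^+ 2.
  rewrite ler_wpM2r ?sqr_ge0// -mulrA ler_piMr ?(ltW L_gt0)//.
  by rewrite ler_pdivrMr// mul1r lerDl.
move=> hgap IHs; have := weighted_step S0 rho_gt0 hgap.
rewrite (four_point (x s.+2)) !(four_point (w s.+1)) !subrr !normr0 expr0n /=
  (distrC (x s.+2) (x s.+1)).
move: hy hk hx hKd hd0 hw0 hKds hL IHs {hgap}; rewrite !(invfM 2 rho).
by case: chi => /=; lra.
Qed.

(** Dividing the invariant by its weight [t (t + 1) / 2]: the squared distances on
    the left are nonnegative, and the one on the right is absorbed by means of
    the operator norm. *)
Lemma gap_le u t : dom_conjugate F u -> (1 <= t < N)%N ->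
  gap u t.+1 <=
  2 * L * diam X ^+ 2 / (t%:R * (t%:R + 1)) +
  1 / (t%:R + 1) *
    (chi%:R * rho * opnorm K ^+ 2 * diam X ^+ 2
     + (1 - chi%:R) * rho * diam_image X K ^+ 2
     + diam (dom_conjugate F) ^+ 2 / rho).
Proof.
move=> Fu /andP[t0 tN]; have := gap_potential_le Fu tN.
have hK : `|K (x t.+1) - ws| ^+ 2 <= opnorm K ^+ 2 * `|x t.+1 - xs| ^+ 2.
  have le := opnorm_ge (x t.+1 - xs) boundedK; rewrite linearB -wsE in le.
  by rewrite -exprMn lerXn2r ?nnegrE//; exact: le_trans le.
set C := _ + _ / rho; set T := t%:R.
have T0 : 0 < T by rewrite ltr0n.
have T1 : 0 < T + 1 by rewrite ltr_wpDl// ltW.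
have hKT := ler_wpM2l (_ : 0 <= T * rho / 2) hK.
have {}hKT := hKT (ltW (divr_gt0 (mulr_gt0 T0 rho_gt0) (ltr0Sn _ _))).
have hw : 0 <= T * rho / 2 * `|w t.+1 - ws| ^+ 2.
  by rewrite mulr_ge0 ?sqr_ge0// divr_ge0// ltW// mulr_gt0.
have hx : 0 <= L * `|x t.+1 - xs| ^+ 2 by rewrite mulr_ge0 ?sqr_ge0// ltW.
have hy : 0 <= T * (`|y t.+1 - u| ^+ 2 / (2 * rho)).
  by rewrite mulr_ge0 ?(ltW T0)// divr_ge0 ?sqr_ge0// ltW// mulr_gt0.
move=> hpot.
have main : T * (T + 1) / 2 * gap u t.+1 <= L * diam X ^+ 2 + T / 2 * C.
  by move: hpot hKT hw hx hy; case: chi => /=; lra.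
have TT : 0 < T * (T + 1) / 2 by rewrite divr_gt0// mulr_gt0.
rewrite -(ler_pM2l TT); apply: le_trans main _; rewrite le_eqVlt; apply/orP; left.
by apply/eqP; field; rewrite !gt_eqF.
Qed.

(** The averaged iterates may violate the constraint; testing the gap with a
    subgradient at [K (xag t)] exactly pays for moving [wag t] there. *)
Lemma objective_le_gap u t : subgradient F (K (xag t)) u ->
  G (xag t) + F (K (xag t)) - (G xs + F ws) <= gap u t.
Proof. by move=> /(_ (wag t)); rewrite /gap; lra. Qed.

End iterates.

Theorem theorem2p6
  (R : realType) (V Y : euclideanType R)
  (X : set V) (G : V -> R) (gradG : V -> V) (F : Y -> R)
  (K : {linear V -> Y}) (LG : R)
  (ws : Y) (xs : V) (ys : Y)
  (chi : bool) (N : nat) (rho : R) (alpha theta tau rhos eta : nat -> R)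
  (xmd x xag : nat -> V) (w wag : nat -> Y) (y yag : nat -> Y)
  (closedX : closed X) (convexX : convex_set X)
  (convexG : convex_function X G) (lscG : lower_semicontinuous_on X G)
  (convexF : convex_function [set: Y] F)
  (lscF : lower_semicontinuous (fun v => (F v)%:E))
  (boundedK : bounded_fun_norm K)
  (gradGP : continuously_differentiable_on X G gradG)
  (LG_gt0 : 0 < LG)
  (LGP : forall x1 x2, X x1 -> X x2 ->
    G x2 - G x1 - '[gradG x1, x2 - x1] <= LG / 2 * `|x2 - x1| ^+ 2)
  (optimal : is_optimal X G F K (idfun : {linear Y -> Y}) 0 ws xs)
  (saddle : is_saddle_point X G F K (idfun : {linear Y -> Y}) 0 ws xs ys)
  (compactX : compact X) (compactY : compact (dom_conjugate F))
  (domF0 : dom_conjugate F 0)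
  (rho_gt0 : 0 < rho)
  (run : AADMM X F K (idfun : {linear Y -> Y}) 0 gradG chi N
           alpha theta tau rhos eta xmd x xag w wag y yag)
  (alphaE : forall t, (1 <= t < N)%N -> alpha t = 2 / (t%:R + 1))
  (tauE : forall t, (1 <= t < N)%N -> tau t = rho)
  (rhosE : forall t, (1 <= t < N)%N -> rhos t = rho)
  (thetaE : forall t, (1 <= t < N)%N -> theta t = (t%:R - 1) * rho / t%:R)
  (etaE : forall t, (1 <= t < N)%N ->
    eta t = (2 * LG + chi%:R * rho * t%:R * opnorm K ^+ 2) / t%:R) :
  let fstar := G xs + F ws in
  let DX := diam X in
  let DXK := diam_image X K in
  let DY := diam (dom_conjugate F) in
  (forall t, (1 <= t < N)%N ->
    G (xag t.+1) + F (K (xag t.+1)) - fstar <=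
      2 * LG * DX ^+ 2 / (t%:R * (t%:R + 1)) +
      1 / (t%:R + 1) *
        (chi%:R * rho * opnorm K ^+ 2 * DX ^+ 2
         + (1 - chi%:R) * rho * DXK ^+ 2 + DY ^+ 2 / rho)) /\
  (rho = DY / (chi%:R * opnorm K * DX + (1 - chi%:R) * DXK) ->
   forall t, (1 <= t < N)%N ->
    G (xag t.+1) + F (K (xag t.+1)) - fstar <=
      2 * LG * DX ^+ 2 / (t%:R * (t%:R + 1)) +
      2 / (t%:R + 1) *
        (chi%:R * opnorm K * DX * DY + (1 - chi%:R) * DXK * DY)).
Proof.
have [[Xxs feas] _] := optimal.
have wsE : ws = K xs by apply/eqP; rewrite -subr_eq0; apply/eqP.
have [gradG_on _] := gradGP.
move=> fstar DX DXK DY.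
have bound t : (1 <= t < N)%N ->
    G (xag t.+1) + F (K (xag t.+1)) - fstar <=
      2 * LG * DX ^+ 2 / (t%:R * (t%:R + 1)) +
      1 / (t%:R + 1) *
        (chi%:R * rho * opnorm K ^+ 2 * DX ^+ 2
         + (1 - chi%:R) * rho * DXK ^+ 2 + DY ^+ 2 / rho).
  move=> tN; have [u Fu] := exists_subgradient (K (xag t.+1)) convexF.
  apply: le_trans (objective_le_gap (ws := ws) (xs := xs) (wag := wag) Fu) _.
  exact: (gap_le convexX convexG convexF boundedK gradG_on LG_gt0 LGP Xxs wsE
    compactX compactY domF0 rho_gt0 run alphaE tauE rhosE thetaE etaE
    (subgradient_dom_conjugate Fu) tN).
(* For this [rho] the terms increasing and decreasing in [rho] are equal. *)
split=> // rhoE t tN; apply: le_trans (bound t tN) _; rewrite lerD2l.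
rewrite le_eqVlt; apply/orP; left; apply/eqP.
move: rhoE; set a := chi%:R * opnorm K * DX + (1 - chi%:R) * DXK => rhoE.
have a0 : a != 0.
  by apply: contraTneq rho_gt0 => a0; rewrite rhoE a0 invr0 mulr0 ltxx.
have DYE : DY = rho * a by rewrite rhoE divfK.
have -> : DY ^+ 2 / rho = a * DY by rewrite DYE; field; rewrite gt_eqF.
have aE : chi%:R * rho * opnorm K ^+ 2 * DX ^+ 2 + (1 - chi%:R) * rho * DXK ^+ 2
    = a * DY.
  by rewrite DYE /a; case: (chi) => /=; ring.
by rewrite aE /a; ring.
Qed.
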